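(* There is a universal constant $C>0$ such that the following holds. Let $G=(V,E)$ be any graph with $n$ vertices and maximum degree $d_{\max}$, let $k\ge1$, and let $\lambda_k$ be the $k$-th smallest Laplacian eigenvalue of $G$. Let $\omega:V\to[0,\infty)$ satisfy $\sum_{v\in V}\omega(v)^2=1$. Put $\varepsilon=\varepsilon_{\lfloor n/8k\rfloor}(G,\omega)$ and $\beta=\beta_{\varepsilon/2}(V,\mathsf{dist}_\omega)$. If $\beta^2/\varepsilon^2\le n/64$, then $$\lambda_k\le C\,\frac{d_{\max}}{\varepsilon^2 n}\,\beta^2.$$
   Context: The Laplacian of $G$ is $D-A$ ($D$ degree matrix, $A$ adjacency matrix), eigenvalues in nondecreasing order. For $u,v\in V$, $\mathcal P_{uv}$ is the set of paths in $G$ from $u$ to $v$; for a path $p$, $\omega(p)=\sum_{x\in p}\omega(x)$ (sum over the vertices of $p$), and $\mathsf{dist}_\omega(u,v)=\min_{p\in\mathcal P_{uv}}\omega(p)$ (a semimetric). $\omega$ is $(r,\varepsilon)$-spreading if for every $S\subseteq V$ with $|S|=r$, $\frac{1}{|S|^2}\sum_{u,v\in S}\mathsf{dist}_\omega(u,v)\ge\varepsilon\sqrt{\sum_{v\in V}\omega(v)^2}$; $\varepsilon_r(G,\omega)$ is the maximal $\varepsilon$ for which $\omega$ is $(r,\varepsilon)$-spreading. For a finite (semi)metric space $(X,d)$, $B(x,R)=\{y: d(x,y)\le R\}$. For a partition $P$ of $X$ (with $P(x)$ the part containing $x$) and $\Delta>0$, $\beta(P,\Delta)$ is the infimal $\beta\ge1$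 such that $|\{x\in X: B(x,\Delta/\beta)\subseteq P(x)\}|\ge|X|/2$; $\mathcal P_\Delta$ is the set of partitions all of whose parts have diameter at most $\Delta$; and $\beta_\Delta(X,d)=\inf\{\beta(P,\Delta):P\in\mathcal P_\Delta\}$. *)

(* Defs.v *)
From HB Require Import structures.
From mathcomp Require Import all_boot all_order all_algebra.
From mathcomp Require Import boolp classical_sets reals constructive_ereal ereal.
From mathcomp Require Import Rstruct.
Set Implicit Arguments. Unset Strict Implicit. Unset Printing Implicit Defensive.
Import Order.TTheory GRing.Theory Num.Theory.
Local Open Scope ring_scope.
Local Open Scope classical_set_scope.

Notation R := Rdefinitions.R.

Section GraphDefs.
Variable V : finType.
Variable adj : rel V.

Definition simple_graph := symmetric adj /\ irreflexive adj.

Definition deg (v : V) : nat := #|[set u | adj v u]|.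
Definition dmax : nat := \max_(v : V) deg v.

Definition laplacian : 'M[R]_#|V| :=
  \matrix_(i, j) (if i == j then (deg (enum_val i))%:R
                  else - (adj (enum_val i) (enum_val j))%:R).

Definition laplacian_kth_eigenvalue (k : nat) (lam : R) : Prop :=
  exists s : seq R,
    [/\ sorted <=%R s, size s = #|V|,
        char_poly laplacian = \prod_(x <- s) ('X - x%:P),
        (0 < k <= #|V|)%N & lam = nth 0 s k.-1].

Definition is_path (u v : V) (p : seq V) : Prop :=
  [/\ p <> [::], uniq p, path adj (head u p) (behead p),
      head u p = u & last u p = v].

Variable w : V -> R.

Definition wpath (p : seq V) : R := \sum_(x <- p) w x.

(* dist_omega(u,v) = min over paths; +oo when there is no path *)
Definition dist (u v : V) : \bar R :=
  ereal_inf [set (wpath p)%:E | p in is_path u v].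

Definition l2norm : R := Num.sqrt (\sum_(v : V) w v ^+ 2).

Definition spreading (r : nat) (eps : R) : Prop :=
  forall S : {set V}, #|S| = r ->
    (((#|S|%:R ^+ 2)^-1)%:E * \sum_(u in S) \sum_(v in S) dist u v
       >= (eps * l2norm)%:E)%E.

Definition eps_r (r : nat) : \bar R := ereal_sup [set e%:E | e in spreading r].

Definition ball (x : V) (rad : R) : {set V} :=
  [set y | `[< (dist x y <= rad%:E)%E >]]%SET.

Definition is_partition (P : {set {set V}}) : Prop := finset.partition P [set: V].

Definition beta_P (P : {set {set V}}) (Delta : R) : \bar R :=
  ereal_inf [set b%:E | b in
    [set b : R | 1 <= b /\
      ((#|V|%:R / 2 : R) <= #|[set x | ball x (Delta / b) \subset finset.pblock P x]%SET|%:R)]].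

Definition bounded_partition (Delta : R) (P : {set {set V}}) : Prop :=
  is_partition P /\
  forall A, A \in P -> forall x y, x \in A -> y \in A -> (dist x y <= Delta%:E)%E.

Definition beta_Delta (Delta : R) : \bar R :=
  ereal_inf [set beta_P P Delta | P in bounded_partition Delta].

End GraphDefs.

(* Main.v *)
(* By the min-max principle it suffices to exhibit k disjointly supported test
   functions of Rayleigh quotient O(d_max beta^2 / (eps^2 n)).  Take a partition P
   of diameter at most eps/2 that nearly realizes beta, and rho = eps/(2b) with b
   slightly above beta.  The spreading property forces every part to have fewer
   than n/8k vertices.  Call x good when B(x, rho) lies in its part and
   w(x) <= 3rho/4; at least 3n/8 vertices are good, because few vertices have
   large weight when beta^2/eps^2 <= n/64.  The parts can be grouped greedily
   into 2k unions, each containing a set T_j of at least n/16k good vertices, and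
   f_j(x) = max(0, rho - dist(T_j, x)) is supported in the j-th union, is at least
   rho/4 on T_j, and varies along an edge uv by at most max(w(u), w(v)).  Hence
   the energies of the f_j add up to O(d_max), and the k cheapest ones work. *)
Require Import Defs.
From HB Require Import structures.
From mathcomp Require Import all_boot all_order all_algebra complex.
From mathcomp Require Import boolp classical_sets reals constructive_ereal ereal.
From mathcomp Require Import Rstruct ring lra zify.
Set Implicit Arguments. Unset Strict Implicit. Unset Printing Implicit Defensive.
Import Order.TTheory GRing.Theory Num.Theory.
Local Open Scope ring_scope.

(** * Min-max bounds for Hermitian and real symmetric matrices *)

Lemma char_poly_conj (F : fieldType) (n : nat) (P A : 'M[F]_n) :
  P \in unitmx -> char_poly (invmx P *m A *m P) = char_poly A.
Proof.
move=> Pu; rewrite /char_poly.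
have PV : map_mx polyC (invmx P) *m map_mx polyC P = 1%:M.
  by rewrite -map_mxM mulVmx // map_mx1.
have -> : char_poly_mx (invmx P *m A *m P)
    = map_mx polyC (invmx P) *m char_poly_mx A *m map_mx polyC P.
  rewrite /char_poly_mx mulmxBr mulmxBl !map_mxM /=; congr (_ - _).
  by rewrite -mulmxA -scalar_mxC mulmxA PV mul1mx.
by rewrite !det_mulmx mulrAC -[\det _ * \det _]det_mulmx PV det1 mul1r.
Qed.

Lemma left_kernel_of_wide (F : fieldType) (k m : nat) (A : 'M[F]_(k, m)) :
  (m < k)%N -> exists2 c : 'rV[F]_k, c != 0 & c *m A = 0.
Proof.
move=> ltmk; have : kermx A != 0.
  by rewrite kermx_eq0 -row_leq_rank -ltnNge (leq_ltn_trans (rank_leq_col A)).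
by case/rowV0Pn=> c /sub_kermxP cA c0; exists c.
Qed.

Section CourantFischer.
Local Open Scope sesquilinear_scope.

Lemma mulmx_tconj (C : numClosedFieldType) (n : nat) (x : 'rV[C]_n) :
  (x *m x^t*) 0 0 = \sum_i `|x 0 i| ^+ 2.
Proof. by rewrite mxE; apply: eq_bigr => i _; rewrite !mxE normCK. Qed.

Lemma mulmx_diag_tconj (C : numClosedFieldType) (n : nat) (d x : 'rV[C]_n) :
  (x *m diag_mx d *m x^t*) 0 0 = \sum_i d 0 i * `|x 0 i| ^+ 2.
Proof.
rewrite mxE; apply: eq_bigr => i _.
by rewrite mul_mx_diag !mxE normCK mulrAC mulrC.
Qed.

(** One half of the min-max principle, in counting form: with fewer than k eigenvalues up to [mu], a
    dimension count puts into the row space of [F] a nonzero vector orthogonal to their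
    eigenvectors, where the form exceeds [mu] times the norm. *)
Lemma hermitian_count_eigenvalue_le (C : numClosedFieldType) (n k : nat)
    (A : 'M[C]_n) (s : seq C) (mu : C) (F : 'M[C]_(k, n)) :
  A \is hermsymmx -> char_poly A = \prod_(x <- s) ('X - x%:P) ->
  mu \is Num.real ->
  (forall c : 'rV[C]_k, c != 0 -> c *m F != 0) ->
  (forall c : 'rV[C]_k, let x := c *m F in
    (x *m A *m x^t*) 0 0 <= mu * (x *m x^t*) 0 0) ->
  (k <= count (<= mu) s)%N.
Proof.
move=> Ah charA mur Finj FR; rewrite leqNgt; apply/negP => ltk.
have /orthomx_spectralP := hermitian_normalmx Ah.
have := spectral_unitarymx A; have := hermitian_spectral_diag_real Ah.
set P := spectralmx A; set d := spectral_diag A => /mxOverP dr PU Aeq.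
have Pu := unitarymx_unit PU.
have sd : perm_eq s [seq d 0 i | i : 'I_n].
  apply: prod_XsubC_eq; rewrite -charA Aeq char_poly_conj //.
  rewrite char_poly_trig ?diag_mx_is_trig // big_map big_enum /=.
  by apply: eq_bigr => i _; rewrite mxE eqxx mulr1n.
(* With more test vectors than eigenvalues at most mu, some nonzero combination
   is orthogonal to all the eigenvectors indexed by D. *)
pose D := [set i | d 0 i <= mu].
have cD : count (<= mu) s = #|D|.
  rewrite (permP sd) -sum1_count big_map big_enum_cond -sum1_card.
  by apply: eq_bigl => i; rewrite !inE.
have [c c0 cK] : exists2 c : 'rV[C]_k, c != 0 &
    c *m colsub (@enum_val _ (mem D)) (F *m P^t*) = 0.
  by apply: left_kernel_of_wide; rewrite -cD.
pose y := c *m F *m P^t*.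
have yD i : d 0 i <= mu -> y 0 i = 0.
  move=> di; have iD : i \in D by rewrite inE.
  have /rowP/(_ (enum_rank_in iD i)) := cK.
  rewrite /y -mulmxA [RHS]mxE => <-; rewrite mxE [RHS]mxE; apply: eq_bigr => j _.
  by rewrite [in RHS]mxE enum_rankK_in.
have yP : c *m F = y *m P.
  by rewrite /y -mulmxA -invmx_unitary // mulVmx // mulmx1.
have := FR c; rewrite /= yP.
rewrite trmx_mul map_mxM /= !mulmxA.
rewrite (mulmxtVK _ PU) {1}Aeq invmx_unitary // !mulmxA.
rewrite (mulmxtVK _ PU) (mulmxtVK _ PU) mulmx_diag_tconj mulmx_tconj.
rewrite -subr_ge0 mulr_sumr -sumrB => le0.
(* The terms [(d 0 i - mu) * |y 0 i|^2] are nonnegative and their sum is at most 0, so all vanish.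
   This kills [y] where [d 0 i > mu]; [yD] kills it elsewhere. *)
suff y0 : y = 0 by have := Finj c c0; rewrite yP y0 mul0mx eqxx.
have tge0 i : 0 <= d 0 i * `|y 0 i| ^+ 2 - mu * `|y 0 i| ^+ 2.
  have [|lt] := real_leP (dr 0 i) mur.
    by move/yD->; rewrite normr0 expr0n /= !mulr0 subrr.
  by rewrite -mulrBl mulr_ge0 ?subr_ge0 ?(ltW lt) // exprn_ge0.
have /eqP : \sum_i (d 0 i * `|y 0 i| ^+ 2 - mu * `|y 0 i| ^+ 2) = 0.
  apply/eqP; rewrite eq_le sumr_ge0 // andbT -oppr_ge0 -sumrN.
  by move: le0; congr (0 <= _); apply: eq_bigr => i _; rewrite opprB.
rewrite psumr_eq0 // => /allP /= all0; apply/rowP => i; rewrite [RHS]mxE.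
have [|lt] := real_leP (dr 0 i) mur.
  exact: yD.
have := all0 i (mem_index_enum i); rewrite -mulrBl mulf_eq0 subr_eq0.
by rewrite (gt_eqF lt) /= expf_eq0 normr_eq0 => /eqP.
Qed.

End CourantFischer.

Section CourantFischerReal.
Local Open Scope sesquilinear_scope.
Variable K : rcfType.
Local Notation toC := (map_mx (real_complex K)).

Lemma complex_row_split (n : nat) (c : 'rV[K[i]]_n) :
  exists a b : 'rV[K]_n, c = toC a + 'i%C *: toC b.
Proof.
exists (map_mx (@complex.Re K) c), (map_mx (@complex.Im K) c).
by apply/rowP => i; rewrite !mxE -complexE.
Qed.


(** The two imaginary cross terms cancel because [A] is symmetric. *)
Lemma hermitian_form_split (n : nat) (A : 'M[K]_n) (u v : 'rV[K]_n) :
  A^T = A -> let x := toC u + 'i%C *: toC v in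
  (x *m toC A *m x^t*) 0 0
    = ((u *m A *m u^T) 0 0 + (v *m A *m v^T) 0 0)%:C%C.
Proof.
move=> As x.
have -> : x^t* = toC u^T - 'i%C *: toC v^T.
  apply/colP => i; rewrite !mxE /=.
  have -> : forall z : K[i], (z^*)%R = (z^*)%C by [].
  by simpc.
have uv : v *m A *m u^T = u *m A *m v^T.
  have tr11 (M : 'M[K]_1) : M^T = M by apply/matrixP => i j; rewrite mxE !ord1.
  by rewrite -[LHS]tr11 !trmx_mul trmxK As mulmxA.
rewrite /x !mulmxDl mulmxBr mulmxBr -!scalemxAl -!scalemxAr -!map_mxM uv /=.
rewrite scalerA -expr2 sqr_i scaleN1r opprK addrA subrK.
by rewrite -map_mxD [LHS]mxE; congr (_%:C%C); rewrite [LHS]mxE.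
Qed.

(** Diagonalization takes place over [K[i]]. Splitting coefficients into real and imaginary parts
    carries the real hypotheses on [F] over to complex combinations. *)
Lemma symmetric_nth_eigenvalue_le (n k : nat) (A : 'M[K]_n) (s : seq K)
    (mu : K) (F : 'M[K]_(k, n)) :
  A^T = A -> char_poly A = \prod_(x <- s) ('X - x%:P) ->
  sorted <=%R s -> (0 < k)%N ->
  (forall c : 'rV[K]_k, c != 0 -> c *m F != 0) ->
  (forall c : 'rV[K]_k, let x := c *m F in
    (x *m A *m x^T) 0 0 <= mu * (x *m x^T) 0 0) ->
  nth 0 s k.-1 <= mu.
Proof.
move=> As charA ss k0 Finj FR; apply: nth_count_le => //; rewrite prednK //.
have -> : count (<= mu) s = count (<= mu%:C%C) [seq x%:C%C | x <- s].
  by rewrite count_map; apply: eq_count => x /=; rewrite lecR.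
have splitM (a b : 'rV[K]_k) : (toC a + 'i%C *: toC b) *m toC F
    = toC (a *m F) + 'i%C *: toC (b *m F).
  by rewrite mulmxDl -scalemxAl -!map_mxM.
apply: (@hermitian_count_eigenvalue_le _ _ _ (toC A) _ _ (toC F)).
- apply/is_hermitianmxP; rewrite expr0 scale1r -{1}As.
  apply/matrixP => i j; rewrite !mxE.
  have -> : forall z : K[i], (z^*)%R = (z^*)%C by [].
  by rewrite conjc_real.
- rewrite -map_char_poly charA rmorph_prod big_map.
  by apply: eq_bigr => x _; rewrite /= map_polyXsubC.
- by rewrite complex_real.
- move=> c; have [a [b ->]] := complex_row_split c; rewrite splitM.
  apply: contra_neq => /rowP x0.
  have uv0 : a *m F = 0 /\ b *m F = 0.
    split; apply/rowP => i; have /eqP := x0 i; rewrite !mxE;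
    by simpc; rewrite eq_complex /= => /andP[/eqP ? /eqP ?].
  have inj0 (e : 'rV[K]_k) : e *m F = 0 -> e = 0.
    by move=> e0; apply: contraTeq isT => /Finj; rewrite e0 eqxx.
  by rewrite (inj0 a uv0.1) (inj0 b uv0.2) map_mx0 scaler0 addr0.
- move=> c /=; have [a [b ->]] := complex_row_split c; rewrite splitM.
  rewrite hermitian_form_split //.
  set x := _ + _ *: _.
  have := @hermitian_form_split n 1%:M (a *m F) (b *m F) (trmx1 _ _).
  rewrite /= map_mx1 !mulmx1 -/x => ->.
  by rewrite -rmorphM lecR mulrDr lerD.
Qed.

End CourantFischerReal.

(** * Cauchy-Schwarz and an averaging argument *)

Lemma sqr_sum_le_card (K : realDomainType) (I : finType) (D : {set I})
    (z : I -> K) :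
  (\sum_(i in D) z i) ^+ 2 <= #|D|%:R * \sum_(i in D) z i ^+ 2.
Proof.
have : 0 <= \sum_(i in D) \sum_(j in D) (z i - z j) ^+ 2.
  by apply: sumr_ge0 => i _; apply: sumr_ge0 => j _; exact: sqr_ge0.
have -> : \sum_(i in D) \sum_(j in D) (z i - z j) ^+ 2
    = 2 * (#|D|%:R * (\sum_(i in D) z i ^+ 2)) - 2 * (\sum_(i in D) z i) ^+ 2.
  transitivity (\sum_(i in D) (#|D|%:R * z i ^+ 2 + \sum_(j in D) z j ^+ 2
                               - 2 * (z i * \sum_(j in D) z j))).
    apply: eq_bigr => i _; rewrite mulr_natl -sumr_const.
    rewrite !mulr_sumr -big_split /= -sumrB; apply: eq_bigr => j _; ring.
  rewrite sumrB big_split /= sumr_const -!mulr_sumr -mulr_suml; ring.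
by rewrite -mulrBr pmulr_rge0 // subr_ge0.
Qed.

(** Otherwise more than k of the 2k values exceed S/k, and together they exceed S. *)
Lemma exists_k_small (K : realFieldType) (k : nat) (E : 'I_(2 * k) -> K) (S : K) :
  (0 < k)%N -> (forall j, 0 <= E j) -> \sum_j E j <= S ->
  exists2 f : 'I_k -> 'I_(2 * k), injective f & forall i, E (f i) <= S / k%:R.
Proof.
move=> k0 E0 ES; pose D := [set j | E j <= S / k%:R].
have kR : 0 < k%:R :> K by rewrite ltr0n.
have kD : (k <= #|D|)%N.
  rewrite leqNgt; apply/negP => ltD.
  have cD : (k < #|~: D|)%N by have := cardsC D; rewrite card_ord; lia.
  have /card_gt0P [j0 j0D] : (0 < #|~: D|)%N by apply: leq_trans cD.
  have S0 : 0 <= S by apply: le_trans ES; apply: sumr_ge0.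
  have : S < \sum_j E j.
    apply: (@lt_le_trans _ _ (\sum_(j in ~: D) E j)); last first.
      rewrite [leRHS](bigID (mem (~: D))) /= lerDl.
      exact: sumr_ge0.
    apply: (@le_lt_trans _ _ (\sum_(j in ~: D) S / k%:R)).
      rewrite sumr_const -[leRHS]mulr_natl mulrA ler_pdivlMr // mulrC.
      by rewrite ler_wpM2r // ler_nat ltnW.
    apply: ltr_sum; last by move=> j; rewrite !inE -ltNge.
    by apply/hasP; exists j0; rewrite ?mem_index_enum.
  by rewrite ltNge ES.
exists (fun i => enum_val (widen_ord kD i)).
  by move=> i j /enum_val_inj /(congr1 val) /= ?; apply: val_inj.
by move=> i; have := enum_valP (widen_ord kD i); rewrite inE.
Qed.

(** * Dirichlet energy and disjointly supported test functions *)

Section Energy.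
Variables (V : finType) (adj : rel V).

(* Both orientations of an edge are summed: this is twice the Laplacian form. *)
Definition energy (f : V -> R) : R :=
  \sum_u \sum_v (adj u v)%:R * (f u - f v) ^+ 2.

Definition vertex_row (f : V -> R) : 'rV[R]_#|V| := \row_i f (enum_val i).

Lemma sum_enum_val (G : V -> R) :
  \sum_(i < #|V|) G (enum_val i) = \sum_v G v.
Proof.
by rewrite [RHS](reindex (@enum_val V V)) //; apply: onW_bij; exact: enum_val_bij.
Qed.

Lemma degE (u : V) : (deg adj u)%:R = \sum_v (adj u v)%:R :> R.
Proof.
rewrite /deg -sum1_card natr_sum big_mkcond /=; apply: eq_bigr => v _.
(* The set inside [deg] is a classical one, so membership goes through [asbool]. *)
have -> : (v \in [set` adj u]%classic) = adj u v by exact: asboolb.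
by case: (adj u v).
Qed.

Lemma vertex_row_norm (f : V -> R) :
  (vertex_row f *m (vertex_row f)^T) 0 0 = \sum_v f v ^+ 2.
Proof. by rewrite mxE -sum_enum_val; apply: eq_bigr => i _; rewrite !mxE. Qed.

Lemma energy_ge0 (f : V -> R) : 0 <= energy f.
Proof.
by apply: sumr_ge0 => u _; apply: sumr_ge0 => v _; rewrite mulr_ge0 ?sqr_ge0.
Qed.

Lemma sum_adj_swap (h : V -> R) : symmetric adj ->
  \sum_u \sum_v (adj u v)%:R * h v = \sum_u (deg adj u)%:R * h u.
Proof.
move=> As; rewrite exchange_big /=; apply: eq_bigr => v _.
by rewrite -mulr_suml degE; congr (_ * _); apply: eq_bigr => u _; rewrite As.
Qed.

Lemma laplacian_formE (f : V -> R) : simple_graph adj ->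
  (vertex_row f *m laplacian adj *m (vertex_row f)^T) 0 0 = energy f / 2.
Proof.
move=> [As Ai].
have -> : (vertex_row f *m laplacian adj *m (vertex_row f)^T) 0 0
    = \sum_v \sum_u f u * (if u == v then (deg adj u)%:R
                           else - (adj u v)%:R) * f v.
  rewrite mxE -sum_enum_val; apply: eq_bigr => j _.
  rewrite !mxE mulr_suml -sum_enum_val; apply: eq_bigr => i _.
  by rewrite !mxE (inj_eq enum_val_inj).
have -> : \sum_v \sum_u f u * (if u == v then (deg adj u)%:R
                           else - (adj u v)%:R) * f v
   = \sum_u (deg adj u)%:R * f u ^+ 2
     - \sum_v \sum_u (adj u v)%:R * (f u * f v).
  rewrite -sumrB; apply: eq_bigr => v _.
  rewrite (bigD1 v) //= eqxx [in RHS](bigD1 v) //= Ai mul0r add0r -sumrN.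
  congr (_ + _); first by ring.
  by apply: eq_bigr => u /negbTE ->; ring.
have -> : energy f = 2 * (\sum_u (deg adj u)%:R * f u ^+ 2)
     - 2 * \sum_v \sum_u (adj u v)%:R * (f u * f v).
  transitivity (\sum_u (deg adj u)%:R * f u ^+ 2
    + (\sum_u \sum_v (adj u v)%:R * f v ^+ 2)
    - 2 * \sum_u \sum_v (adj u v)%:R * (f v * f u)).
    rewrite mulr_sumr -big_split -sumrB /=; apply: eq_bigr => u _.
    rewrite degE mulr_suml mulr_sumr -big_split -sumrB /=.
    by apply: eq_bigr => v _; ring.
  rewrite sum_adj_swap //.
  have -> : \sum_u \sum_v (adj u v)%:R * (f v * f u)
      = \sum_v \sum_u (adj u v)%:R * (f u * f v).
    by apply: eq_bigr => u _; apply: eq_bigr => v _; rewrite As.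
  by ring.
by field.
Qed.

Lemma laplacian_sym : symmetric adj -> (laplacian adj)^T = laplacian adj.
Proof.
move=> As; apply/matrixP => i j; rewrite !mxE eq_sym As.
by case: eqP => [->|].
Qed.

Definition disjoint_supports (I : finType) (F : I -> V -> R) : Prop :=
  forall i j u, F i u != 0 -> F j u != 0 -> i = j.

(** Each endpoint lies in at most one support. *)
Lemma card_edge_support (I : finType) (F : I -> V -> R) (u v : V) :
  disjoint_supports F ->
  (#|[set i | (F i u != 0%R) || (F i v != 0%R)]| <= 2)%N.
Proof.
move=> dF.
have le1 w : (#|[set i | F i w != 0%R]| <= 1)%N.
  by apply/card_le1_eqP => i j; rewrite !inE => iw jw; exact: dF jw iw.
have -> : [set i | (F i u != 0) || (F i v != 0)]
    = [set i | F i u != 0] :|: [set i | F i v != 0].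
  by apply/setP => i; rewrite !inE.
rewrite (leq_trans (leq_card_setU _ _)) //.
exact: (leq_add (le1 u) (le1 v)).
Qed.

(** An edge may join two supports, so cross terms survive; at most two indices matter on it, and
    Cauchy-Schwarz then costs a factor 2. *)
Lemma energy_combination (I : finType) (F : I -> V -> R) (c : I -> R) :
  disjoint_supports F ->
  energy (fun u => \sum_i c i * F i u) <= 2 * \sum_i c i ^+ 2 * energy (F i).
Proof.
move=> dF.
have -> : 2 * \sum_i c i ^+ 2 * energy (F i) = \sum_u \sum_v (adj u v)%:R *
    (2 * \sum_i (c i * (F i u - F i v)) ^+ 2).
  rewrite /energy mulr_sumr.
  under eq_bigr do rewrite mulr_sumr mulr_sumr.
  rewrite exchange_big /=; apply: eq_bigr => u _.
  under eq_bigr do rewrite mulr_sumr mulr_sumr.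
  rewrite exchange_big /=; apply: eq_bigr => v _.
  by rewrite !mulr_sumr; apply: eq_bigr => i _; ring.
apply: ler_sum => u _; apply: ler_sum => v _; apply: ler_wpM2l; first by [].
pose D := [set i | (F i u != 0) || (F i v != 0)].
pose z i := c i * (F i u - F i v).
have z0 i : i \notin D -> z i = 0.
  by rewrite inE negb_or !negbK /z => /andP[/eqP-> /eqP->]; rewrite subrr mulr0.
have -> : \sum_i c i * F i u - \sum_i c i * F i v = \sum_(i in D) z i.
  rewrite -sumrB [RHS]big_mkcond; apply: eq_bigr => i _ /=.
  by rewrite -mulrBr -/(z i); case: ifPn => // /z0.
apply: le_trans (sqr_sum_le_card _ _) _.
apply: ler_pM.
- by [].
- by apply: sumr_ge0 => i _; exact: sqr_ge0.
- by rewrite ler_nat; exact: card_edge_support.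
- rewrite [leRHS](bigID (mem D)) /= lerDl.
  by apply: sumr_ge0 => i _; exact: sqr_ge0.
Qed.

Lemma norm_combination (I : finType) (F : I -> V -> R) (c : I -> R) :
  disjoint_supports F ->
  \sum_u (\sum_i c i * F i u) ^+ 2 = \sum_i c i ^+ 2 * \sum_u F i u ^+ 2.
Proof.
move=> dF; under [RHS]eq_bigr do rewrite mulr_sumr.
rewrite [RHS]exchange_big /=; apply: eq_bigr => u _.
have [/existsP [i iu]|] := boolP [exists i, F i u != 0].
  have F0 j : j != i -> F j u = 0.
    by apply: contra_neq_eq => ju; exact: dF ju iu.
  rewrite (bigD1 i) //= big1 ?addr0 ?exprMn; last first.
    by move=> j /F0 ->; rewrite mulr0.
  rewrite [RHS](bigD1 i) //= [X in _ + X]big1 ?addr0 // => j /F0 ->.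
  by rewrite expr0n mulr0.
rewrite negb_exists => /forallP F0.
have {}F0 i : F i u = 0 by apply/eqP; have := F0 i; rewrite negbK.
rewrite !big1 ?expr0n // => i _; rewrite F0 ?expr0n mulr0 //.
Qed.

(** The 2 from [energy_combination] cancels the 1/2 in [laplacian_formE], so the Rayleigh quotient
    is at most E/N on the whole span. The lower bound N also makes the functions independent. *)
Lemma laplacian_kth_eigenvalue_le (k : nat) (lam E N : R)
    (F : 'I_k -> V -> R) :
  simple_graph adj -> laplacian_kth_eigenvalue adj k lam ->
  disjoint_supports F -> 0 < N ->
  (forall i, energy (F i) <= E) -> (forall i, N <= \sum_u F i u ^+ 2) ->
  lam <= E / N.
Proof.
move=> sg [s [ss szs cs /andP[k0 kV] ->]] dF N0 FE FN.
pose M : 'M[R]_(k, #|V|) := \matrix_(i, j) F i (enum_val j).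
have MM (c : 'rV[R]_k) : c *m M = vertex_row (fun u => \sum_i c 0 i * F i u).
  by apply/rowP => j; rewrite !mxE; apply: eq_bigr => i _; rewrite !mxE.
have normM (c : 'rV[R]_k) : N * \sum_i c 0 i ^+ 2
    <= ((c *m M) *m (c *m M)^T) 0 0.
  rewrite MM vertex_row_norm norm_combination // mulr_sumr.
  by apply: ler_sum => i _; rewrite mulrC ler_wpM2l ?sqr_ge0.
apply: (@symmetric_nth_eigenvalue_le _ _ _ (laplacian adj) s _ M) => //.
- exact: laplacian_sym sg.1.
- move=> c; apply: contra_neq => cM0.
  have := normM c; rewrite cM0 mul0mx mxE pmulr_rle0 // => le0.
  have /eqP : \sum_i c 0 i ^+ 2 = 0.
    by apply/eqP; rewrite eq_le le0 sumr_ge0 // => i _; exact: sqr_ge0.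
  rewrite psumr_eq0; last by move=> i _; exact: sqr_ge0.
  move=> /allP /= c0; apply/rowP => i; rewrite mxE.
  by have := c0 i (mem_index_enum i); rewrite sqrf_eq0 => /eqP.
- move=> c /=; have E0 : 0 <= E.
    by apply: le_trans (FE (Ordinal k0)); exact: energy_ge0.
  apply: (@le_trans _ _ (E * \sum_i c 0 i ^+ 2)); last first.
    by rewrite -mulrA ler_wpM2l // mulrC ler_pdivlMr // mulrC normM.
  rewrite MM laplacian_formE // ler_pdivrMr // mulrC.
  apply: le_trans (energy_combination _ dF) _.
  rewrite ler_pM2l // mulr_sumr.
  by apply: ler_sum => i _; rewrite mulrC ler_wpM2r ?sqr_ge0.
Qed.

(** Each ordered edge is charged by at most two functions, and each vertex then pays from both ends
    of its incident edges: hence 4. *)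
Lemma sum_energy_le (I : finType) (F : I -> V -> R) (w : V -> R) :
  symmetric adj -> disjoint_supports F ->
  (forall i u v, adj u v -> (F i u - F i v) ^+ 2 <= w u ^+ 2 + w v ^+ 2) ->
  \sum_i energy (F i) <= 4 * (dmax adj)%:R * \sum_v w v ^+ 2.
Proof.
move=> As dF lipF.
have edge u v : \sum_i (adj u v)%:R * (F i u - F i v) ^+ 2
    <= (adj u v)%:R * (2 * (w u ^+ 2 + w v ^+ 2)).
  case: (boolP (adj u v)) => [uv|_]; last first.
    by rewrite big1 ?mul0r // => i _; rewrite mul0r.
  rewrite mul1r; under eq_bigr do rewrite mul1r.
  pose D := [set i | (F i u != 0) || (F i v != 0)].
  rewrite (bigID (mem D)) /= [X in _ + X]big1 ?addr0; last first.
    move=> i; rewrite inE negb_or !negbK => /andP[/eqP-> /eqP->].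
    by rewrite subrr expr0n.
  apply: (@le_trans _ _ (\sum_(i in D) (w u ^+ 2 + w v ^+ 2))).
    by apply: ler_sum => i _; exact: lipF.
  rewrite sumr_const -[leLHS]mulr_natl ler_wpM2r ?addr_ge0 ?sqr_ge0 //.
  by rewrite ler_nat; exact: card_edge_support.
apply: (@le_trans _ _ (\sum_u \sum_v (adj u v)%:R * (2 * (w u ^+ 2 + w v ^+ 2)))).
  rewrite /energy exchange_big /=; apply: ler_sum => u _.
  by rewrite exchange_big /=; apply: ler_sum => v _; exact: edge.
have -> : \sum_u \sum_v (adj u v)%:R * (2 * (w u ^+ 2 + w v ^+ 2))
    = 4 * \sum_u (deg adj u)%:R * w u ^+ 2.
  transitivity (\sum_u 2 * ((deg adj u)%:R * w u ^+ 2)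
    + 2 * \sum_u \sum_v (adj u v)%:R * w v ^+ 2).
    rewrite mulr_sumr -big_split /=; apply: eq_bigr => u _.
    rewrite degE mulr_suml !mulr_sumr -big_split /=.
    by apply: eq_bigr => v _; ring.
  by rewrite sum_adj_swap // -mulr_sumr; ring.
rewrite -mulrA ler_pM2l // mulr_sumr; apply: ler_sum => u _.
rewrite ler_wpM2r ?sqr_ge0 // ler_nat; exact: leq_bigmax.
Qed.

End Energy.

(** * The vertex-weighted distance and its bump functions *)

Section Distance.
Variables (V : finType) (adj : rel V) (w : V -> R).
Hypothesis w_ge0 : forall v, 0 <= w v.

Lemma wpath_ge0 (p : seq V) : 0 <= wpath w p.
Proof. by apply: sumr_ge0. Qed.

Lemma dist_ge0 (u v : V) : (0%:E <= dist adj w u v)%E.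
Proof.
by apply: le_ereal_inf_tmp => _ [p _ <-]; rewrite lee_fin wpath_ge0.
Qed.

Lemma dist_le_wpath (u v : V) (p : seq V) :
  is_path adj u v p -> (dist adj w u v <= (wpath w p)%:E)%E.
Proof. by move=> uvp; apply: ereal_inf_lbound; exists p. Qed.

(* [dist u u] is [w u], not [0]: the weight of the trivial path counts. *)
Lemma dist_refl_le (u : V) : (dist adj w u u <= (w u)%:E)%E.
Proof. by rewrite -[w u](big_seq1 +%R); apply: dist_le_wpath; split. Qed.

Lemma dist_adj_le (y u v : V) : adj u v ->
  (dist adj w y v <= dist adj w y u + (w v)%:E)%E.
Proof.
move=> uv; rewrite -leeBlDr //; apply: le_ereal_inf_tmp => _ [p pP <-].
rewrite leeBlDr // -EFinD.
suff [q qP le_q] : exists2 q, is_path adj y v q & wpath w q <= wpath w p + w v.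
  by apply: le_trans (dist_le_wpath qP) _; rewrite lee_fin.
case: p pP => [[]//|x p [_ up pp /= xy lu]]; subst x.
(* Paths are simple: if [v] is new it is appended, otherwise the path is cut at its occurrence of
   [v], which cannot raise the weight. *)
have [vp|vp] := boolP (v \in y :: p); last first.
  exists (rcons (y :: p) v); last by rewrite /wpath big_rcons /= addrC.
  split=> //=; last by rewrite last_rcons.
  - by rewrite -[_ && _]/(uniq (rcons (y :: p) v)) rcons_uniq vp.
  - by rewrite rcons_path pp lu.
have [v_y|] := eqVneq v y.
  subst v; exists [:: y]; first by split.
  by rewrite /wpath big_seq1 lerDr wpath_ge0.
move=> vy; move: vp; rewrite inE (negbTE vy) /= => vp.
case/splitPr: vp up pp lu => p1 p2 up pp lu.
exists (y :: rcons p1 v).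
  split=> //=; last by rewrite last_rcons.
  - by move: up; rewrite -cat_rcons -cat_cons cat_uniq => /andP[].
  - by move: pp; rewrite -cat_rcons cat_path => /andP[].
rewrite /wpath -cat_rcons -cat_cons big_cat /= -addrA lerDl addr_ge0 //.
exact: wpath_ge0.
Qed.

Variable rho : R.

(** The cap keeps the value real when no path exists; distances beyond [rho] do not affect the
    bump. *)
Definition capped_dist (y x : V) : R := fine (mine rho%:E (dist adj w y x)).

Lemma capped_distE (y x : V) :
  (capped_dist y x)%:E = mine rho%:E (dist adj w y x).
Proof.
rewrite /capped_dist fineK // minElt; case: ifP => // /negbT.
rewrite -leNgt => le_rho; rewrite fin_real // (lt_le_trans (ltNy0) (dist_ge0 y x)).
by rewrite (le_lt_trans le_rho) ?ltry.
Qed.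

Lemma capped_dist_adj_le (y u v : V) :
  adj u v -> capped_dist y v <= capped_dist y u + w v.
Proof.
move=> uv; rewrite -lee_fin EFinD !capped_distE.
rewrite [X in (_ <= X + _)%E]minElt; case: ifP => _.
  by rewrite ge_min -EFinD lee_fin lerDl w_ge0.
by rewrite ge_min dist_adj_le // orbT.
Qed.

Lemma capped_dist_refl_le (y : V) : capped_dist y y <= w y.
Proof. by rewrite -lee_fin capped_distE ge_min dist_refl_le orbT. Qed.

Lemma capped_dist_lt (y x : V) :
  capped_dist y x < rho -> x \in Defs.ball adj w y rho.
Proof.
rewrite -lte_fin capped_distE gt_min ltxx /= => ltr.
by rewrite inE; apply/asboolP/ltW.
Qed.

(** This is max(0, rho - dist(T, x)), with value 0 for empty [T]. *)
Definition dist_bump (T : {set V}) (x : V) : R :=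
  \big[Num.max/0]_(y in T) (rho - capped_dist y x).

Lemma dist_bump_ge0 (T : {set V}) (x : V) : 0 <= dist_bump T x.
Proof. exact: bigmax_ge_id. Qed.

Lemma dist_bump_ge (T : {set V}) (y : V) : y \in T -> rho - w y <= dist_bump T y.
Proof.
move=> yT; apply: le_trans (le_bigmax_cond _ _ yT).
by rewrite lerD2l lerN2 capped_dist_refl_le.
Qed.

Lemma dist_bump_adj_le (T : {set V}) (u v : V) : adj u v ->
  dist_bump T u <= dist_bump T v + w v.
Proof.
move=> uv; apply: bigmax_le => [|y yT]; first by rewrite addr_ge0 ?dist_bump_ge0.
rewrite -lerBlDr; apply: le_trans (le_bigmax_cond _ _ yT).
by have := capped_dist_adj_le y uv; lra.
Qed.

(** In either direction the increase is at most the weight of one endpoint. *)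
Lemma dist_bump_edge (T : {set V}) (u v : V) : symmetric adj -> adj u v ->
  (dist_bump T u - dist_bump T v) ^+ 2 <= w u ^+ 2 + w v ^+ 2.
Proof.
move=> As uv; have vu : adj v u by rewrite As.
have := dist_bump_adj_le T uv; have := dist_bump_adj_le T vu.
have := w_ge0 u; have := w_ge0 v.
by have [le|/ltW le] := leP (dist_bump T u) (dist_bump T v); nra.
Qed.

Lemma dist_bump_neq0 (T : {set V}) (x : V) : dist_bump T x != 0 ->
  exists2 y, y \in T & x \in Defs.ball adj w y rho.
Proof.
move=> bx; have [/exists_inP //|] :=
  boolP [exists y in T, x \in Defs.ball adj w y rho].
rewrite negb_exists_in => /forall_inP far; case/negP: bx.
rewrite eq_le dist_bump_ge0 andbT; apply: bigmax_le => // y /far.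
by rewrite subr_le0 leNgt; apply: contra; exact: capped_dist_lt.
Qed.

End Distance.

(** * Small parts, greedy grouping and counting *)

(** An r-subset of [A] would have average distance at most eps/2, bounding every admissible
    spreading constant, and so their supremum eps, by eps/2. *)
Lemma small_diameter_card (V : finType) (adj : rel V) (w : V -> R) (r : nat)
    (eps : R) (A : {set V}) :
  l2norm w = 1 -> eps_r adj w r = eps%:E -> 0 < eps ->
  (forall x y, x \in A -> y \in A -> (dist adj w x y <= (eps / 2)%:E)%E) ->
  (#|A| < r)%N.
Proof.
move=> w1 epsE eps0 diamA; rewrite ltnNge; apply/negP => /card_geqP [s [us szs sA]].
suff : (eps%:E <= (eps / 2)%:E)%E by rewrite lee_fin; lra.
rewrite -epsE; apply: ge_ereal_sup => _ [e spr <-].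
pose S := [set x in s].
have cS : #|S| = r by rewrite cardsE (card_uniqP us).
have {spr} := spr S cS; rewrite w1 mulr1 => /le_trans; apply.
have sumle : (\sum_(u in S) \sum_(v in S) dist adj w u v
    <= (r%:R * (r%:R * (eps / 2)))%:E)%E.
  apply: (@le_trans _ _ (\sum_(u in S) \sum_(v in S) (eps / 2)%:E)%E).
    apply: lee_sum => u; rewrite inE => /sA uA.
    by apply: lee_sum => v; rewrite inE => /sA vA; exact: diamA.
  under eq_bigr do rewrite sumEFin sumr_const cS.
  by rewrite sumEFin sumr_const cS lee_fin !mulr_natl.
apply: (@le_trans _ _ (((r%:R ^+ 2)^-1)%:E * (r%:R * (r%:R * (eps / 2)))%:E)%E).
  by rewrite cS; apply: lee_wpmul2l => //; rewrite lee_fin invr_ge0 exprn_ge0.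
(* For r = 0 the average is 0, so this case too contradicts eps > 0. *)
rewrite -EFinM lee_fin; have [->|r0] := eqVneq r 0%N.
  by rewrite mul0r mulr0; lra.
have r0' : r%:R != 0 :> R by rewrite pnatr_eq0.
by rewrite le_eqVlt; apply/orP; left; apply/eqP; field.
Qed.

(** A minimal subset of mass at least s has mass at most s + r, since removing any element drops it
    below s. Splitting it off leaves enough for the other groups. *)
Lemma greedy_grouping (K : realFieldType) (I : finType) (m : I -> K) (r s : K)
    (n : nat) (Q : {set I}) :
  0 <= s -> 0 <= r -> (forall i, 0 <= m i) -> (forall i, i \in Q -> m i <= r) ->
  n%:R * (s + r) <= \sum_(i in Q) m i ->
  exists g : I -> nat, forall j, (j < n)%N ->
    s <= \sum_(i in Q | g i == j) m i.
Proof.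
move=> s0 r0 m0; elim: n Q => [|n IH] Q mr le_sum; first by exists (fun=> 0%N).
pose heavy := [pred D : {set I} | s <= \sum_(i in D) m i].
have Qheavy : heavy Q.
  rewrite /heavy /=; apply: le_trans le_sum; rewrite -natr1.
  by have := mulr_ge0 (ler0n K n) (addr_ge0 s0 r0); lra.
have [D /minsetP [/= Dheavy minD] DQ] := minset_exists (P := heavy) Qheavy.
have D_le : \sum_(i in D) m i <= s + r.
  have [D0|/set0Pn [i iD]] := eqVneq D finset.set0.
    by rewrite D0 big_set0 addr_ge0.
  have iQ := fintype.subsetP DQ i iD.
  rewrite (big_setD1 i iD) /= addrC lerD ?mr //.
  rewrite leNgt; apply/negP => /ltW lt_s.
  have /setP/(_ i) := minD _ lt_s (subD1set D i).
  by rewrite !inE eqxx iD.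
have sumQ : \sum_(i in Q) m i
    = \sum_(i in D) m i + \sum_(i in (Q :\: D)%SET) m i.
  rewrite (big_setID D) /=; congr (_ + _); apply: eq_bigl => i.
  by rewrite (finset.setIidPr DQ).
have [||g gP] := IH (Q :\: D)%SET.
- by move=> i; rewrite inE => /andP[_]; exact: mr.
- by move: le_sum; rewrite sumQ -natr1; lra.
(* [g] may also take the value [n] outside [D]; this only adds mass to the last group. *)
exists (fun i => if i \in D then n else g i) => j.
rewrite ltnS leq_eqVlt => /orP[/eqP ->|jn].
  apply: (le_trans Dheavy); rewrite [leRHS](bigID (mem D)) /=.
  apply: ler_wpDr; first exact: sumr_ge0.
  rewrite le_eqVlt; apply/orP; left; apply/eqP; apply: eq_bigl => i.
  have := fintype.subsetP DQ i.
  by case: (i \in D) => //= [->//|_]; rewrite ?eqxx ?andbF.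
apply: le_trans (gP j jn) _; rewrite le_eqVlt; apply/orP; left; apply/eqP.
apply: eq_bigl => i; rewrite inE; case: (i \in D) => //=.
by rewrite (gtn_eqF jn) andbF.
Qed.

(** Translates masses of blocks into cardinalities: of all of [T] for trivial [q], of one group when
    [q] tests a label. *)
Lemma card_pblock_fiber (V : finType) (P : {set {set V}}) (T : {set V})
    (q : pred {set V}) :
  finset.partition P [set: V]%SET ->
  #|[set x in T | q (finset.pblock P x)]%SET|
    = (\sum_(A in P | q A) #|(T :&: A)%SET|)%N.
Proof.
move=> Ppart; have /and3P[/eqP covP trivP _] := Ppart.
have Pin x : finset.pblock P x \in P by rewrite pblock_mem // covP inE.
rewrite -sum1_card.
rewrite (partition_big (finset.pblock P) [pred A in P | q A]) /=; last first.
  by move=> x; rewrite inE => /andP[_ ->]; rewrite Pin.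
apply: eq_bigr => A /andP[AP qA]; rewrite -sum1_card; apply: eq_bigl => x.
rewrite !inE; have <- : (finset.pblock P x == A) = (x \in A).
  apply/eqP/idP => [<-|xA]; first by rewrite mem_pblock covP inE.
  exact: def_pblock.
by case: eqP => [->|]; rewrite ?andbF ?andbT // qA andbT.
Qed.

(** As beta is at least 1, [c * beta] lies strictly above it, so both nested infima yield witnesses
    below it. *)
Lemma beta_Delta_witness (V : finType) (adj : rel V) (w : V -> R)
    (Delta beta c : R) :
  beta_Delta adj w Delta = beta%:E -> 1 < c ->
  exists P b, [/\ bounded_partition adj w Delta P, 1 <= b, b < c * beta &
    #|V|%:R / 2 <= #|[set x | Defs.ball adj w x (Delta / b)
                                \subset finset.pblock P x]%SET|%:R :> R].
Proof.
move=> betaE c1.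
have beta1 : 1 <= beta.
  rewrite -lee_fin -betaE; apply: le_ereal_inf_tmp => _ [P _ <-].
  by apply: le_ereal_inf_tmp => _ [b [b1 _] <-]; rewrite lee_fin.
have : (beta_Delta adj w Delta < (c * beta)%:E)%E.
  by rewrite betaE lte_fin ltr_pMl // (lt_le_trans ltr01).
move=> /ereal_inf_lt [_ [P Pb <-]] /ereal_inf_lt [_ [b [b1 bP] <-]].
by rewrite lte_fin => bc; exists P, b.
Qed.

Lemma card_gt_mul_le (V : finType) (w : V -> R) (t : R) : 0 <= t ->
  #|[set x | t < w x]%SET|%:R * t ^+ 2 <= \sum_v w v ^+ 2.
Proof.
move=> t0; rewrite mulr_natl -sumr_const.
rewrite [leRHS](bigID (mem [set x | t < w x]%SET)) /=.
apply: ler_wpDr; first by apply: sumr_ge0 => v _; exact: sqr_ge0.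
apply: ler_sum => v; rewrite inE => /ltW tv.
by rewrite lerXn2r // nnegrE (le_trans t0).
Qed.

(** * From a partition to the eigenvalue bound *)

Lemma eigenvalue_le_of_partition (V : finType) (adj : rel V) (w : V -> R)
    (k r : nat) (rho lam : R) (P : {set {set V}}) :
  simple_graph adj -> (forall v, 0 <= w v) -> \sum_v w v ^+ 2 = 1 ->
  (0 < k)%N -> (r * (8 * k) <= #|V|)%N -> 0 < rho ->
  finset.partition P [set: V]%SET -> (forall A, A \in P -> (#|A| < r)%N) ->
  3 / 8 * #|V|%:R <=
    #|[set x | (Defs.ball adj w x rho \subset finset.pblock P x)
               && (w x <= 3 / 4 * rho)]%SET|%:R :> R ->
  laplacian_kth_eigenvalue adj k lam ->
  lam <= 1024 * (dmax adj)%:R / (#|V|%:R * rho ^+ 2).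
Proof.
move=> sg w0 w1 k0 rk rho0 Ppart Psmall; set T := [set x | _]%SET => cT lamE.
have V0 : 0 < #|V|%:R :> R.
  by case: lamE => s [_ _ _ /andP[k1 kV] _]; rewrite ltr0n (leq_trans k1).
have kR : 0 < k%:R :> R by rewrite ltr0n.
(* Blocks have mass at most n/8k, and 2k (n/16k + n/8k) = 3n/8 is exactly the guaranteed number of
   good vertices. *)
pose sz : R := #|V|%:R / (16 * k%:R).
have sz0 : 0 < sz by rewrite divr_gt0 // mulr_gt0.
have [|A|A AP||g gP] := @greedy_grouping R _ (fun A : {set V} => #|(T :&: A)%SET|%:R)
    (#|V|%:R / (8 * k%:R)) sz (2 * k) P (ltW sz0).
- by rewrite divr_ge0 // mulr_ge0 // ltW.
- by [].
- apply: (@le_trans _ _ r%:R).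
    rewrite ler_nat; apply: leq_trans (ltnW (Psmall A AP)).
    by apply: subset_leq_card; exact: finset.subsetIr.
  by rewrite ler_pdivlMr ?mulr_gt0 // -!natrM ler_nat.
- rewrite -natr_sum; have := card_pblock_fiber T xpredT Ppart.
  rewrite (eq_bigl (mem P)); last by move=> A; rewrite andbT.
  move=> <-; have -> : [set x in T | true]%SET = T.
    by apply/setP => x; rewrite inE andbT.
  apply: le_trans cT; rewrite /sz natrM le_eqVlt; apply/orP; left; apply/eqP.
  by field; rewrite gt_eqF.
pose Tj (j : 'I_(2 * k)) := [set x in T | g (finset.pblock P x) == j]%SET.
have cTj j : sz <= #|Tj j|%:R.
  apply: le_trans (gP j (ltn_ord j)) _; rewrite -natr_sum.
  by rewrite -(@card_pblock_fiber _ _ T (fun A => g A == j) Ppart).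
pose F j := dist_bump adj w rho (Tj j).
(* Such a [u] lies in the ball of a good vertex [y] of group [j], hence in the block of [y]. *)
have Flabel j u : F j u != 0 -> g (finset.pblock P u) = j.
  move=> /(dist_bump_neq0 w0) [y yT uy]; move: yT; rewrite !inE.
  move=> /andP[/andP[/fintype.subsetP/(_ u uy) uPy _] /eqP gy]; rewrite -gy.
  congr (g _); apply: same_pblock uPy.
  by case/and3P: Ppart.
have dF : disjoint_supports F.
  by move=> i j u /Flabel iu /Flabel; rewrite iu; exact: val_inj.
have sumE : \sum_j energy adj (F j) <= 4 * (dmax adj)%:R.
  have lipF j u v : adj u v -> (F j u - F j v) ^+ 2 <= w u ^+ 2 + w v ^+ 2.
    by move=> uv; exact: dist_bump_edge sg.1 uv.
  by have := sum_energy_le sg.1 dF lipF; rewrite w1 mulr1.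
have [f finj fE] := exists_k_small k0 (fun j => energy_ge0 adj (F j)) sumE.
(* Energy 4 dmax / k against squared norm sz (rho/4)^2: 1024 = 4 * 16 * 16. The height rho/4 is rho
   minus the weight bound 3rho/4. *)
have -> : 1024 * (dmax adj)%:R / (#|V|%:R * rho ^+ 2)
    = (4 * (dmax adj)%:R / k%:R) / (sz * (rho / 4) ^+ 2).
  by rewrite /sz; field; rewrite !gt_eqF.
apply: (laplacian_kth_eigenvalue_le (F := fun i => F (f i)) sg lamE) => //.
- by move=> i j u iu ju; apply: finj; exact: dF iu ju.
- by rewrite mulr_gt0 // exprn_gt0 // divr_gt0.
- move=> i; rewrite [leRHS](bigID (mem (Tj (f i)))) /=.
  apply: ler_wpDr; first by apply: sumr_ge0 => v _; exact: sqr_ge0.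
  apply: (@le_trans _ _ (\sum_(v in Tj (f i)) (rho / 4) ^+ 2)).
    by rewrite sumr_const -[leRHS]mulr_natl ler_wpM2r // sqr_ge0.
  apply: ler_sum => v vT; have := dist_bump_ge adj w0 rho vT.
  have : w v <= 3 / 4 * rho by move: vT; rewrite !inE => /andP[/andP[_]].
  rewrite -/(F (f i)) => wv bv; rewrite lerXn2r // ?nnegrE; last by lra.
  + by rewrite divr_ge0 // ltW.
  + by rewrite dist_bump_ge0.
Qed.

Theorem theorem2p3 :
  exists C : R, 0 < C /\
  forall (V : finType) (adj : rel V), simple_graph adj ->
  forall (k : nat), (1 <= k)%N ->
  forall (w : V -> R), (forall v, 0 <= w v) -> \sum_(v : V) w v ^+ 2 = 1 ->
  forall (eps beta lam : R),
    eps_r adj w (#|V| %/ (8 * k)) = eps%:E ->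
    0 < eps ->
    beta_Delta adj w (eps / 2) = beta%:E ->
    beta ^+ 2 / eps ^+ 2 <= #|V|%:R / 64 ->
    laplacian_kth_eigenvalue adj k lam ->
    lam <= C * ((dmax adj)%:R / (eps ^+ 2 * #|V|%:R)) * beta ^+ 2.
Proof.
(* The argument gives 4096 * (21/20)^2, which is less than 4516. *)
exists 5000; split; first by rewrite ltr0n.
move=> V adj sg k k1 w w0 w1 eps beta lam epsE eps0 betaE be lamE.
have V0 : 0 < #|V|%:R :> R.
  by case: lamE => s [_ _ _ /andP[k0 kV] _]; rewrite ltr0n (leq_trans k0).
(* The infimum defining beta need not be attained. *)
have c1 : (1 : R) < 21 / 20 by lra.
have [P [b [[Ppart Pdiam] b1 bc good]]] := beta_Delta_witness betaE c1.
have b0 : 0 < b by apply: lt_le_trans b1.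
have b2 : b ^+ 2 <= 441 / 400 * beta ^+ 2 by nra.
pose rho := eps / 2 / b.
have rho0 : 0 < rho by rewrite !divr_gt0.
have rho2 : eps ^+ 2 = 4 * b ^+ 2 * rho ^+ 2 by rewrite /rho; field; rewrite gt_eqF.
(* The hypothesis on beta^2/eps^2, with eps^2 = 4 b^2 rho^2 and beta^2 at least 400/441 b^2. *)
have nrho : 16 * 400 / 441 <= #|V|%:R * rho ^+ 2.
  move: be; rewrite ler_pdivrMr ?exprn_gt0 // rho2 => be.
  have : 16 * 400 / 441 * b ^+ 2 <= (#|V|%:R * rho ^+ 2) * b ^+ 2 by lra.
  by rewrite ler_pM2r // exprn_gt0.
have l2 : l2norm w = 1 by rewrite /l2norm w1 sqrtr1.
have Psmall A : A \in P -> (#|A| < #|V| %/ (8 * k))%N.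
  by move=> AP; apply: (small_diameter_card l2 epsE eps0); exact: Pdiam.
have := eigenvalue_le_of_partition sg w0 w1 k1 (leq_divM _ _) rho0 Ppart
  Psmall _ lamE.
set T := [set x | _]%SET => lam_le.
have {}lam_le : lam <= 1024 * (dmax adj)%:R / (#|V|%:R * rho ^+ 2).
  apply: lam_le; pose H := [set x | 3 / 4 * rho < w x]%SET.
  (* Markov gives |H| at most 16/(9 rho^2), and [nrho] turns this into 0.1225 n. Removing [H] from
     the n/2 padded vertices leaves 3n/8. *)
  have cH : #|H|%:R <= #|V|%:R / 8 :> R.
    have := card_gt_mul_le w (ltW (_ : 0 < 3 / 4 * rho)).
    rewrite w1 -/H => /(_ _); rewrite mulr_gt0 // => /(_ isT) le1.
    have r2 : 0 < rho ^+ 2 by rewrite exprn_gt0.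
    by rewrite -(ler_pM2r r2); lra.
  have : (#|[set x | Defs.ball adj w x rho \subset finset.pblock P x]%SET|
          <= #|T| + #|H|)%N.
    apply: leq_trans (leq_card_setU _ _); apply: subset_leq_card.
    by apply/fintype.subsetP => x; rewrite !inE => ->; rewrite ltNge /= orbN.
  rewrite -(ler_nat R) natrD; move: good; rewrite -/rho; lra.
apply: le_trans lam_le _.
have -> : 1024 * (dmax adj)%:R / (#|V|%:R * rho ^+ 2)
    = 4096 * ((dmax adj)%:R / (eps ^+ 2 * #|V|%:R)) * b ^+ 2.
  by rewrite rho2; field; rewrite !gt_eqF.
have : 0 <= (dmax adj)%:R / (eps ^+ 2 * #|V|%:R) :> R.
  by rewrite divr_ge0 // mulr_ge0 // ?sqr_ge0.
set q := _ / _ => q0; nra.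
Qed.
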